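(* Let $N\ge 1$, let $p_c:=\frac{2N}{N+1}<p\le 2$ and $0<q<p-1$. Let $u_0\in W^{1,\infty}(\mathbb{R}^N)$ satisfy $u_0\ge 0$, $u_0\not\equiv 0$, and $$u_0(x)\le C_0(1+|x|)^{-q/(1-q)},\qquad x\in\mathbb{R}^N,$$ for some $C_0>0$. Let $u$ be the solution to $\partial_t u-\Delta_p u+|\nabla u|^q=0$ in $(0,\infty)\times\mathbb{R}^N$ with $u(0)=u_0$. Then extinction in finite time takes place: there exists $T_e\in(0,\infty)$ such that $u(T_e,x)=0$ for any $x\in\mathbb{R}^N$, but $\|u(t)\|_\infty>0$ for any $t\in(0,T_e)$.
   Context: $\Delta_p u=\mathrm{div}(|\nabla u|^{p-2}\nabla u)$. For $p\in(p_c,2]$, $q>0$ and $u_0\in W^{1,\infty}(\mathbb{R}^N)$ with $u_0\ge0$, $u_0\not\equiv0$, it is known that the Cauchy problem $\partial_t u-\Delta_p u+|\nabla u|^q=0$ in $(0,\infty)\times\mathbb{R}^N$, $u(0)=u_0$, has a unique nonnegative viscosity solution $u\in\mathcal{BC}([0,\infty)\times\mathbb{R}^N)\cap L^\infty(0,\infty;W^{1,\infty}(\mathbb{R}^N))$ ($\mathcal{BC}$: bounded continuous functions), which is also a weak solution if $p<2$ and a classical solution if $p=2$, and satisfies $0\le u\le\|u_0\|_\infty$. ''The solution'' means this one. *)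

(* Defs.v *)
From HB Require Import structures.
From mathcomp Require Import all_boot all_order all_algebra.
From mathcomp Require Import all_classical all_reals all_analysis.

Set Implicit Arguments.
Unset Strict Implicit.
Unset Printing Implicit Defensive.

Import Order.TTheory GRing.Theory Num.Theory.
Import numFieldNormedType.Exports.

Local Open Scope classical_set_scope.
Local Open Scope ring_scope.

Section calculus.
Variable R : realType.

(* The library norm of 'rV[R]_N is the sup norm, hence a separate Euclidean
   norm. *)
Definition enorm N (x : 'rV[R]_N) : R := Num.sqrt (\sum_i x 0 i ^+ 2).

(* f is of class C^k on the open set A: in finite dimension it is the same to
   ask for the partial derivatives along a basis or along all vectors v. *)
Fixpoint Ck (k : nat) (V : normedModType R) (A : set V) (f : V -> R) : Prop :=
  (forall z, A z -> {for z, continuous f}) /\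
  (if k is k'.+1 then
     forall v : V, (forall z, A z -> derivable f z v) /\ Ck k' A ('D_v f)
   else True).

Definition partial N (i : 'I_N) (f : 'rV[R]_N -> R) : 'rV[R]_N -> R :=
  'D_('e_i) f.

Definition grad N (f : 'rV[R]_N -> R) (x : 'rV[R]_N) : 'rV[R]_N :=
  \row_i partial i f x.

Definition plaplacian N (p : R) (f : 'rV[R]_N -> R) (x : 'rV[R]_N) : R :=
  \sum_i partial i (fun y => enorm (grad f y) `^ (p - 2) * partial i f y) x.

End calculus.

Section sobolev.
Variable R : realType.

(* Integral over R^N with respect to the Lebesgue measure, as an iterated
   one-dimensional integral. By Fubini this is the usual integral for Borel
   functions that are bounded with bounded support, the only ones to which it
   is applied below. *)
Fixpoint integral_rV (N : nat) : ('rV[R]_N -> R) -> R :=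
  match N return ('rV[R]_N -> R) -> R with
  | 0 => fun F => F 0
  | n.+1 => fun F =>
      Rintegral lebesgue_measure setT
        (fun s : R =>
           integral_rV (fun y : 'rV[R]_n => F (row_mx (s%:M : 'rV[R]_1) y)))
  end.

Definition borel_fun N (f : 'rV[R]_N -> R) : Prop :=
  forall A : set R, open A -> <<s @open 'rV[R]_N >> (f @^-1` A).

(* C_c^\infty(R^N) *)
Definition test_function N (phi : 'rV[R]_N -> R) : Prop :=
  (forall k, Ck k setT phi) /\
  (exists r : R, forall x, r <= enorm x -> phi x = 0).

Definition weak_partial N (i : 'I_N) (f g : 'rV[R]_N -> R) : Prop :=
  forall phi, test_function phi ->
    integral_rV (fun x => f x * partial i phi x) =
    - integral_rV (fun x => g x * phi x).

(* f is in W^{1,\infty}(R^N), and f and the components of its weak gradient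
   are bounded by M. The classes in L^\infty(R^N) are represented by Borel
   functions that are bounded everywhere. *)
Definition W1oo_bound N (M : R) (f : 'rV[R]_N -> R) : Prop :=
  [/\ borel_fun f, (forall x, `|f x| <= M) &
      forall i : 'I_N, exists g : 'rV[R]_N -> R,
        [/\ borel_fun g, (forall x, `|g x| <= M) & weak_partial i f g]].

Definition W1oo N (f : 'rV[R]_N -> R) : Prop := exists M, W1oo_bound M f.

(* ||f||_\infty, for a continuous function f *)
Definition supnorm N (f : 'rV[R]_N -> R) : \bar R :=
  ereal_sup [set `|f x|%:E | x in setT].

End sobolev.

Section viscosity.
Variables (R : realType) (N : nat).
Implicit Types (p q t : R) (x : 'rV[R]_N) (u psi : R -> 'rV[R]_N -> R).

Definition dt u t x : R := derive1 (u ^~ x) t.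

(* As Delta_p is singular where the gradient vanishes (if p < 2), the test
   functions are restricted there as in the works of Ishii-Souganidis and
   Ohnuma-Sato. The class F is a class of functions on [0, +oo[; since they
   vanish at 0 together with their first two derivatives, they extend by 0 to
   C^2 functions on R. *)
Definition class_F p (f : R -> R) : Prop :=
  [/\ Ck 2 setT f,
      [/\ f 0 = 0, derive1 f 0 = 0 & derive1n 2 f 0 = 0],
      (forall r, 0 < r -> 0 < derive1n 2 f r) &
      `|derive1 f r| `^ (p - 2) * derive1n 2 f r @[r --> 0^'+] --> (0 : R)].

Definition time_modulus (w : R -> R) : Prop :=
  [/\ {within [set r | 0 <= r], continuous w},
      (forall r, 0 <= r -> 0 <= w r) &
      w r / r @[r --> 0^'+] --> (0 : R)].

Definition admissible p psi : Prop :=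
  Ck 2 [set z : R * 'rV[R]_N | 0 < z.1] (fun z => psi z.1 z.2) /\
  forall t0 x0, 0 < t0 -> grad (psi t0) x0 = 0 ->
    exists f w, [/\ class_F p f, time_modulus w &
      \forall z \near ((t0, x0) : R * 'rV[R]_N),
        `|psi z.1 z.2 - psi t0 x0 - dt psi t0 x0 * (z.1 - t0)|
          <= f (enorm (z.2 - x0)) + w `|z.1 - t0|].

Definition viscosity_subsolution p q u : Prop :=
  forall psi t0 x0, admissible p psi -> 0 < t0 ->
    (\forall z \near ((t0, x0) : R * 'rV[R]_N),
       u z.1 z.2 - psi z.1 z.2 <= u t0 x0 - psi t0 x0) ->
    (grad (psi t0) x0 != 0 ->
       dt psi t0 x0 <=
         plaplacian p (psi t0) x0 - enorm (grad (psi t0) x0) `^ q) /\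
    (grad (psi t0) x0 = 0 -> dt psi t0 x0 <= 0).

Definition viscosity_supersolution p q u : Prop :=
  forall psi t0 x0, admissible p psi -> 0 < t0 ->
    (\forall z \near ((t0, x0) : R * 'rV[R]_N),
       u t0 x0 - psi t0 x0 <= u z.1 z.2 - psi z.1 z.2) ->
    (grad (psi t0) x0 != 0 ->
       plaplacian p (psi t0) x0 - enorm (grad (psi t0) x0) `^ q
         <= dt psi t0 x0) /\
    (grad (psi t0) x0 = 0 -> 0 <= dt psi t0 x0).

(* Semicontinuity is not part of the two previous notions since it is
   subsumed by the continuity required here. *)
Definition viscosity_solution p q u : Prop :=
  [/\ (forall z : R * 'rV[R]_N, 0 < z.1 ->
         {for z, continuous (fun z : R * 'rV[R]_N => u z.1 z.2)}),
      viscosity_subsolution p q u & viscosity_supersolution p q u].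

(* BC([0, +oo[ x R^N) *)
Definition bounded_continuous u : Prop :=
  (exists M : R, forall t x, 0 <= t -> `|u t x| <= M) /\
  {within [set z : R * 'rV[R]_N | 0 <= z.1],
     continuous (fun z => u z.1 z.2)}.

(* L^\infty(0, +oo; W^{1,\infty}(R^N)); measurability in time is automatic for
   the continuous functions u considered here. *)
Definition Loo_W1oo u : Prop :=
  exists M : R,
    {ae (@lebesgue_measure R), forall t, 0 < t -> W1oo_bound M (u t)}.

(* u is the solution to the Cauchy problem
     dt u - Delta_p u + |grad u|^q = 0 in (0, +oo) x R^N,  u(0) = u0. *)
Definition is_solution p q (u0 : 'rV[R]_N -> R) u : Prop :=
  [/\ (forall t x, 0 <= t -> 0 <= u t x),
      bounded_continuous u, Loo_W1oo u,
      viscosity_solution p q u &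
      forall x, u 0 x = u0 x].

End viscosity.

(* Main.v *)
Require Import Defs.
From HB Require Import structures.
From mathcomp Require Import all_boot all_order all_algebra.
From mathcomp Require Import all_classical all_reals all_analysis.
From mathcomp Require Import zify ring lra.

Import Order.TTheory GRing.Theory Num.Theory.
Import numFieldNormedType.Exports.

Local Open Scope classical_set_scope.
Local Open Scope ring_scope.

(** Finite time extinction rests on two comparisons of [u] with an explicit
barrier.  Comparing with a barrier that can itself serve as a test function
asks for no comparison principle between viscosity sub- and supersolutions: if
[u] minus the barrier has a positive interior maximum, the definition of
subsolution applies there and contradicts the strict supersolution inequality.
Only two things have to be arranged: the maximum must be attained on the
unbounded domain, and the test function must be admissible at its critical
points, where [Delta_p] is singular.

The first barrier, [c + eps t + M sum_i ((x_i - x0_i) / rho)^(n+3)] with [n]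
odd, grows at infinity, so that maxima are attained.  It is convex, hence the
singular operator is bounded above by [|grad|^(p-2)] times its Laplacian, and
the absorption [|grad|^q] dominates this on the region where the barrier is
below [M >= sup u] as soon as the power is high (this is where [q < p - 1] is
needed, near the centre [x0]) and [rho] is large.  Its single critical point
is flat enough for the barrier to be admissible.  The outcome is the bound
[u(t, x0) <= sup_{|y - x0| <= rho} u0] with [rho] independent of [t] and [x0]
(lemma [local_upper_bound]): the solution tends to [0] at infinity uniformly in
time (lemma [uniform_decay]).

The second barrier is [W(t, x) = K (T - t)^(m+1) (b + |x_i|)^(-m)] for one
fixed coordinate [i] and [m = q / (1 - q)].  Without diffusion the exponents
make [W] a separated supersolution of [W_t + |grad W|^q = 0], because
[(m + 1) q = m], provided that [K] is small.  The diffusion term carries the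
additional factor [|grad W|^(p-1-q) / (b + |x_i|)], which is negligible when
[b] is large, and the decay of [u0] is exactly what allows [W(0) >= u0] for a
suitable [T].  The ridge of [W] at [x_i = 0] is harmless: the formula for [W]
on either side of it, continued across the ridge, lies above [W] on the other
side.  Instead of [W] one tests with a sum of exponentials of affine functions
of [(t, x_i)] that touches [W] from above; it is smooth and has no critical
point.  Since [u] is small at infinity, the maximum of [u - W - P] is attained,
where [P] is a small increasing function of time that becomes larger than [u]
before [T].  Hence [u <= W] on [[0, T)] (lemma [profile_barrier]) and
[u(T) = 0].  The extinction time is the least zero of [t |-> u(t)].  *)

(** * Calculus of the classes C^k *)

Section smooth.
Context {R : realType} {V : normedModType R}.
Implicit Types (f g : V -> R) (z v : V).

(** Reduces directional derivatives to derivatives of functions of one real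
    variable, for which the chain rule is available. *)
Lemma is_deriveP_line f z v d :
  is_derive z v f d <-> is_derive (0 : R) 1 (fun s : R => f (s *: v + z)) d.
Proof.
have E : 'D_v f z = 'D_1 (fun s : R => f (s *: v + z)) 0.
  rewrite /derive; set g1 := fun s => _; set g2 := fun s => _.
  suff -> : g1 = g2 by [].
  by apply/funext => s; rewrite /g1 /g2 /= addr0 scale0r add0r [_%:A]mulr1.
split=> -[df <-].
  by apply: DeriveDef; [exact: (derivable1P _ _ _).1|rewrite E].
by apply: DeriveDef; [exact: (derivable1P _ _ _).2|rewrite -E].
Qed.

Lemma is_derive_compR (h : R -> R) f z v dh df :
  is_derive (f z) 1 h dh -> is_derive z v f df ->
  is_derive z v (fun y => h (f y)) (dh * df).
Proof.
move=> hh /is_deriveP_line hf; apply/is_deriveP_line.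
have hh' : is_derive (f (0 *: v + z)) 1 h dh by rewrite scale0r add0r.
by have := @is_derive1_comp _ h (fun s : R => f (s *: v + z)) 0 _ _ hh' hf.
Qed.

(** The closure properties below are stated on the whole space, where the
    derivatives of sums and products are equal as functions; the restriction
    to an open set is then obtained by this lemma. *)
Lemma Ck_subset k (A B : set V) f : A `<=` B -> Ck k B f -> Ck k A f.
Proof.
move=> AB; elim: k f => [|k IH] f /= [cf df]; split=> //.
- by move=> z /AB /cf.
- by move=> z /AB /cf.
- by move=> v; have [d1 d2] := df v; split; [move=> z /AB /d1|exact: IH].
Qed.

Lemma Ck_continuous k f : Ck k setT f -> continuous f.
Proof. by case: k => [|k] [cf _] z; exact: cf. Qed.

Lemma Ck_pred k f : Ck k.+1 setT f -> Ck k setT f.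
Proof.
elim: k f => [|k IH] f [cf df]; split=> // v.
by have [d1 d2] := df v; split=> //; exact: IH.
Qed.

Lemma Ck_cst k (c : R) : Ck k setT (cst c : V -> R).
Proof.
elim: k c => [|k IH] c; split=> //; try by move=> z _; exact: cvg_cst.
move=> v; split; first by move=> z _; exact: derivable_cst.
rewrite (_ : 'D_v _ = cst 0) //; by apply/funext => z; rewrite derive_cst.
Qed.

Lemma CkD k f g : Ck k setT f -> Ck k setT g -> Ck k setT (fun z => f z + g z).
Proof.
elim: k f g => [|k IH] f g [cf df] [cg dg]; split=> //;
  try by move=> z _; apply: (@continuousD _ _ _ f g); [exact: cf|exact: cg].
move=> v; have [f1 f2] := df v; have [g1 g2] := dg v; split.
  by move=> z _; apply: (@derivableD _ _ _ f g); [exact: f1|exact: g1].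
rewrite (_ : 'D_v _ = fun z => 'D_v f z + 'D_v g z); first exact: IH.
by apply/funext => z; rewrite (@deriveD _ _ _ f g) //; [exact: f1|exact: g1].
Qed.

Lemma CkM k f g : Ck k setT f -> Ck k setT g -> Ck k setT (fun z => f z * g z).
Proof.
elim: k f g => [|k IH] f g hf hg; have [cf df] := hf; have [cg dg] := hg;
  split=> //;
  try by move=> z _; apply: (@continuousM _ _ f g); [exact: cf|exact: cg].
move=> v; have [f1 f2] := df v; have [g1 g2] := dg v; split.
  by move=> z _; apply: (@derivableM _ _ f g); [exact: f1|exact: g1].
rewrite (_ : 'D_v _ = fun z => f z * 'D_v g z + g z * 'D_v f z).
  by apply: CkD; apply: IH => //; exact: Ck_pred.
by apply/funext => z; rewrite (@deriveM _ _ f g) //; [exact: f1|exact: g1].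
Qed.

Lemma CkX k f n : Ck k setT f -> Ck k setT (fun z => f z ^+ n).
Proof.
move=> hf; elim: n => [|n IH].
  by rewrite (_ : (fun z => _) = cst 1) //; exact: Ck_cst.
rewrite (_ : (fun z => _) = fun z => f z * f z ^+ n); first exact: CkM.
by apply/funext => z; rewrite exprS.
Qed.

Lemma Ck_sum k n (F : 'I_n -> V -> R) : (forall i, Ck k setT (F i)) ->
  Ck k setT (fun z => \sum_i F i z).
Proof.
move=> hF; rewrite (_ : (fun z => _) = \sum_i F i); last first.
  by apply/funext => z; rewrite fct_sumE.
apply: (big_ind (fun f => Ck k setT f)) => //; first exact: Ck_cst.
by move=> f g; exact: CkD.
Qed.

Lemma Ck_expR k f : Ck k setT f -> Ck k setT (fun z => expR (f z)).
Proof.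
elim: k f => [|k IH] f hf; have [cf df] := hf; split=> //;
  try by move=> z _; apply: continuous_comp; [exact: cf|exact: continuous_expR].
move=> v; have [f1 f2] := df v.
have D z : is_derive z v (fun z => expR (f z)) (expR (f z) * 'D_v f z).
  by apply: is_derive_compR; apply: derivableP; exact: f1.
split; first by move=> z _; case: (D z).
rewrite (_ : 'D_v _ = fun z => expR (f z) * 'D_v f z).
  by apply: CkM => //; apply: IH; exact: Ck_pred.
by apply/funext => z; case: (D z).
Qed.

Lemma Ck_additive k f : continuous f ->
  (forall s v z, f (s *: v + z) = s * f v + f z) -> Ck k setT f.
Proof.
move=> cf lf; case: k => [|k]; split=> //; try by move=> z _; exact: cf.
move=> v.
have D z : is_derive z v f (f v).
  apply/is_deriveP_line.
  rewrite (_ : (fun s : R => _) = (fun s => f v *: s) + cst (f z)).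
    by apply: is_derive_eq; rewrite addr0 [LHS]mulr1.
  by apply/funext => s; rewrite lf /= mulrC.
split; first by move=> z _; case: (D z).
rewrite (_ : 'D_v f = cst (f v)); first exact: Ck_cst.
by apply/funext => z; case: (D z).
Qed.

End smooth.

(** * Norms of row vectors *)

Section euclidean_norm.
Context {R : realType} {N : nat}.
Implicit Types y : 'rV[R]_N.

Lemma enorm_ge0 y : 0 <= enorm y.
Proof. exact: sqrtr_ge0. Qed.

Lemma coord_le_enorm y j : `|y 0 j| <= enorm y.
Proof.
rewrite -sqrtr_sqr /enorm ler_sqrt ?sumr_ge0//; last by move=> *; exact: sqr_ge0.
by rewrite (bigD1 j) //= lerDl sumr_ge0 // => *; exact: sqr_ge0.
Qed.

Lemma enorm0 : enorm (0 : 'rV[R]_N) = 0.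
Proof. by rewrite /enorm big1 ?sqrtr0 // => j _; rewrite mxE expr0n. Qed.

Lemma enorm_gt0 y : y != 0 -> 0 < enorm y.
Proof.
move=> y0; rewrite lt_def enorm_ge0 andbT; apply: contraNneq y0 => e0.
apply/eqP/rowP => j; rewrite mxE; apply/eqP; rewrite -normr_eq0 eq_le normr_ge0.
by rewrite andbT -e0 coord_le_enorm.
Qed.

Lemma coord_le_norm y i : `|y 0 i| <= `|y|.
Proof.
rewrite [leRHS]/Num.Def.normr /= mx_normrE; apply/bigmax_geP; right => /=.
by exists (0, i).
Qed.

Lemma norm_coord y : y != 0 -> exists i, `|y| = `|y 0 i|.
Proof.
rewrite -normr_eq0 => /mx_norm_neq0 [[j i] /= E]; exists i.
by rewrite [LHS]E (ord1 j).
Qed.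

Lemma norm_le_enorm y : `|y| <= enorm y.
Proof.
have [->|y0] := eqVneq y 0; first by rewrite normr0 enorm_ge0.
by have [i ->] := norm_coord _ y0; exact: coord_le_enorm.
Qed.

End euclidean_norm.

(** * The p-Laplacian of separable convex functions *)

Section separable.
Context {R : realType} {N : nat}.
Implicit Types (y v : 'rV[R]_N).

Lemma is_derive_coord y v j :
  is_derive y v (fun x : 'rV[R]_N => x 0 j) (v 0 j).
Proof.
apply/is_deriveP_line.
rewrite (_ : (fun s => _) = (fun s : R => v 0 j *: s) + cst (y 0 j)).
  by apply: is_derive_eq; rewrite addr0 [LHS]mulr1.
by apply/funext => s; rewrite !mxE /= mulrC.
Qed.

Variables (p : R) (h h1 h2 : 'I_N -> R -> R) (c : R).
Hypothesis hp2 : p <= 2.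
Hypothesis Dh : forall i (s : R), is_derive s (1 : R) (h i) (h1 i s).
Hypothesis Dh1 : forall i (s : R), is_derive s (1 : R) (h1 i) (h2 i s).
Let f y := c + \sum_i h i (y 0 i).

Lemma partial_separable i y : partial i f y = h1 i (y 0 i).
Proof.
rewrite /partial /f.
have -> : (fun y => c + \sum_i h i (y 0 i)) =
    cst c + \sum_(i < N) (fun y : 'rV[R]_N => h i (y 0 i)).
  by apply/funext => z; rewrite /= fct_sumE.
have D j : is_derive y 'e_i (fun y : 'rV[R]_N => h j (y 0 j))
    (h1 j (y 0 j) * ('e_i : 'rV[R]_N) 0 j).
  by apply: is_derive_compR; exact: is_derive_coord.
rewrite derive_val add0r (bigD1 i) //= !mxE !eqxx mulr1 big1 ?addr0 // => j ji.
by rewrite !mxE eqxx (negbTE ji) mulr0.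
Qed.

Lemma grad_separable y : grad f y = \row_i h1 i (y 0 i).
Proof. by apply/rowP => i; rewrite !mxE partial_separable. Qed.

(** The diffusion term is [|grad f|^(p-2)] times the Laplacian plus
    [(p - 2) |grad f|^(p-4)] times the Hessian evaluated at the gradient; for a
    convex function and [p <= 2] the latter is nonpositive. *)
Lemma plaplacian_separable_le y : grad f y != 0 ->
  (forall i, 0 <= h2 i (y 0 i)) ->
  plaplacian p f y <= enorm (grad f y) `^ (p - 2) * \sum_i h2 i (y 0 i).
Proof.
move=> gy0 h2y; rewrite /plaplacian [leRHS]mulr_sumr; apply: ler_sum => i _.
pose S (z : 'rV[R]_N) : R := \sum_j (h1 j (z 0 j)) ^+ 2.
pose e := (p - 2) / 2.
have S0 z : 0 <= S z by apply: sumr_ge0 => j _; exact: sqr_ge0.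
have ES z : enorm (grad f z) `^ (p - 2) = S z `^ e.
  have -> : enorm (grad f z) = S z `^ 2^-1.
    rewrite powR12_sqrt // grad_separable; congr Num.sqrt.
    by apply: eq_bigr => j _; rewrite mxE.
  by rewrite -powRrM mulrC.
have Sy : 0 < S y.
  have := enorm_gt0 _ gy0; rewrite grad_separable /enorm sqrtr_gt0.
  by rewrite (eq_bigr (fun j => h1 j (y 0 j) ^+ 2)) // => j _; rewrite mxE.
rewrite ES {1}/partial.
have -> : (fun z => enorm (grad f z) `^ (p - 2) * partial i f z) =
    (fun z => S z `^ e) * (fun z => h1 i (z 0 i)).
  by apply/funext => z; rewrite ES partial_separable.
have Dh1y j : is_derive y 'e_i (fun z : 'rV[R]_N => h1 j (z 0 j))
    (h2 j (y 0 j) * ('e_i : 'rV[R]_N) 0 j).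
  by apply: is_derive_compR; exact: is_derive_coord.
have DS : is_derive y 'e_i S (2 * h1 i (y 0 i) * h2 i (y 0 i)).
  rewrite (_ : S = \sum_(j < N) (fun z : 'rV[R]_N => h1 j (z 0 j)) ^+ 2); last first.
    by apply/funext => z; rewrite fct_sumE.
  apply: is_derive_eq; rewrite (bigD1 i) //= big1 ?addr0.
    by rewrite !mxE !eqxx mulr1 expr1.
  by move=> j ji; rewrite !mxE eqxx (negbTE ji) mulr0 scaler0.
have DSe : is_derive y 'e_i (fun z => S z `^ e)
    (e * S y `^ (e - 1) * (2 * h1 i (y 0 i) * h2 i (y 0 i))).
  by apply: (is_derive_compR (fun a => a `^ e)); exact: is_derive1_powR.
rewrite derive_val !mxE !eqxx mulr1 -[leRHS]addr0 lerD2l.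
set a := h1 i (y 0 i); set b := h2 i (y 0 i); set w := S y `^ _.
have -> : a *: (e * w * (2 * a * b)) = - ((2 - p) * w * a ^+ 2 * b).
  by rewrite /e /GRing.scale /=; field.
rewrite oppr_le0; apply: mulr_ge0; last exact: h2y.
by rewrite mulr_ge0 ?sqr_ge0 // mulr_ge0 ?subr_ge0 ?powR_ge0.
Qed.

End separable.

(** * Existence of interior maxima *)

Section maximum.
Context {R : realType} {N : nat}.

(** The bound at [t = T] replaces any discussion of maxima at the final time,
    which would only be one-sided in time. *)
Lemma interior_maximum (Z : R * 'rV[R]_N -> R) (T r t1 : R) (x1 : 'rV[R]_N) :
  {within [set z : R * 'rV[R]_N | 0 <= z.1 <= T], continuous Z} ->
  (forall x, Z (0, x) <= 0) -> (forall x, Z (T, x) <= 0) ->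
  (forall t x, 0 <= t <= T -> r <= `|x| -> Z (t, x) <= 0) ->
  0 <= t1 <= T -> 0 < Z (t1, x1) ->
  exists t0 x0, [/\ 0 < t0, t0 < T, 0 < Z (t0, x0) &
    \forall z \near ((t0, x0) : R * 'rV[R]_N), Z z <= Z (t0, x0)].
Proof.
move=> cZ Z0 ZT Zr t1T Zt1.
pose B := [set x : 'rV[R]_N | `|x| <= r].
have cB : compact B.
  apply: bounded_closed_compact.
    exists r; split; first exact: num_real.
    by move=> M rM x Bx; exact: le_trans Bx (ltW rM).
  by apply: (@closed_comp _ _ (fun x : 'rV[R]_N => `|x|) [set s | s <= r]);
    [move=> x _; exact: norm_continuous|exact: closed_le].
have cK : compact (`[0, T] `*` B).
  by apply: compact_setX => //; exact: segment_compact.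
have inK : (`[0, T] `*` B) (t1, x1).
  split; first by rewrite /= in_itv.
  by rewrite /B /= leNgt; apply/negP => /ltW /(Zr _ _ t1T); rewrite leNgt Zt1.
have cZK : {within `[0, T] `*` B, continuous Z}.
  by apply: continuous_subspaceW cZ => -[t x] [/=]; rewrite in_itv.
have [[t0 x0]] := compact_EVT_max (ex_intro _ _ inK) cK cZK.
rewrite inE => -[/=]; rewrite in_itv /= => /andP[t00 t0T] Bx0 mZ.
have Zpos : 0 < Z (t0, x0).
  by apply: (lt_le_trans Zt1); apply: mZ; rewrite inE.
have {}t00 : 0 < t0.
  rewrite lt_neqAle t00 andbT; apply: contraTneq Zpos => <-.
  by rewrite -leNgt Z0.
have {}t0T : t0 < T.
  rewrite lt_neqAle t0T andbT; apply: contraTneq Zpos => ->.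
  by rewrite -leNgt ZT.
exists t0, x0; split => //.
have nT : \forall z \near ((t0, x0) : R * 'rV[R]_N), 0 < z.1 < T.
  have : \forall t \near t0, 0 < t < T.
    near=> t; apply/andP; split; near: t; [exact: lt_nbhsr|exact: lt_nbhsl].
  move=> H; exists ([set t | 0 < t < T], setT) => /=.
    by split=> //; exact: filterT.
  by move=> -[t x] [].
apply: filterS nT => -[t x] /= /andP[t0' tT'].
have [xr|/ltW rx] := leP `|x| r.
  by apply: mZ; rewrite inE; split=> //=; rewrite in_itv /= !ltW.
by apply: le_trans (ltW Zpos); apply: Zr => //; rewrite !ltW.
Unshelve. all: by end_near. Qed.

End maximum.

(** * The power barrier *)

Section powers.
Context {R : realType}.

Lemma is_derive_pow (A c s : R) n :
  is_derive s (1 : R) (fun s => A * (s - c) ^+ n.+1)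
    (A * (n.+1%:R * (s - c) ^+ n)).
Proof.
rewrite (_ : (fun s => _) = A \*: ((id - cst c) ^+ n.+1)); last first.
  by apply/funext => r; rewrite exprfctE.
by apply: is_derive_eq; rewrite /= subr0 /GRing.scale /= mulr1.
Qed.

Lemma derive1_pow (A c : R) n :
  derive1 (fun s => A * (s - c) ^+ n.+1) = fun s => (A * n.+1%:R) * (s - c) ^+ n.
Proof.
apply/funext => s; rewrite derive1E; have [_ ->] := is_derive_pow A c s n.
by rewrite mulrA.
Qed.

(** The condition at [0] reads [r^((n+2)(p-1) - 1) -> 0]. *)
Lemma class_F_pow (p A : R) n : 0 < A -> 1 < n.+2%:R * (p - 1) ->
  class_F p (fun r => A * r ^+ n.+3).
Proof.
move=> A0 hn.
have D (B : R) k : derive1 (fun r : R => B * r ^+ k.+1) =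
    fun r => (B * k.+1%:R) * r ^+ k.
  have -> : (fun r => B * r ^+ k.+1) = (fun r => B * (r - 0) ^+ k.+1).
    by apply/funext => r; rewrite subr0.
  by rewrite derive1_pow; apply/funext => r; rewrite subr0.
have E1 := D A n.+2.
have E2 : derive1n 2 (fun r => A * r ^+ n.+3) =
    fun r : R => (A * n.+3%:R * n.+2%:R) * r ^+ n.+1.
  by rewrite derive1nS derive1n1 E1 D.
split.
- apply: CkM; first exact: Ck_cst.
  apply: CkX; apply: Ck_additive => // x; exact: cvg_id.
- by rewrite E2 E1 !expr0n /= !mulr0.
- by move=> r r0; rewrite E2 mulr_gt0 ?exprn_gt0 // !mulr_gt0.
rewrite E1 E2.
pose C := (A * n.+3%:R) `^ (p - 2) * (A * n.+3%:R * n.+2%:R).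
pose b := n.+2%:R * (p - 1) - 1.
have b0 : 0 < b by rewrite subr_gt0.
have /(@cvgMr _ _ _ _ _ C) : r `^ b @[r --> (0:R)^'+] --> (0 : R).
  exact: powR_cvg0.
rewrite mulr0; apply: cvg_trans; apply: near_eq_cvg.
near=> r.
have r0 : 0 < r by near: r; exact: nbhs_right_gt.
have A3 : 0 <= A * n.+3%:R by rewrite mulr_ge0 // ltW.
have rk : 0 <= r ^+ n.+2 by rewrite exprn_ge0 // ltW.
rewrite ger0_norm; last exact: mulr_ge0 A3 rk.
rewrite powRM //.
have -> : b = n.+2%:R * (p - 2) + n.+1%:R.
  by rewrite /b -[n.+2]addn1 natrD; ring.
rewrite [r `^ _]powRD ?(gt_eqF r0) ?implybT // powR_mulrn ?(ltW r0) // powRrM.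
by rewrite powR_mulrn ?(ltW r0) // /C; ring.
Unshelve. all: by end_near. Qed.

End powers.

Section power_barrier.
Context {R : realType} {N : nat}.
Implicit Type y : 'rV[R]_N.

(** With [X] the largest [|y_i|] and [Y = A (n+3) X^(n+2) <= |g|], the sum on the
    left is at most [N (n+2) Y / X], so that it suffices to have
    [N (n+2) Y^(p-1-q) <= X].  Since [Y = (n+3) M / rho (X / rho)^(n+2)], the
    exponent of [X / rho <= 1] in [Y^(p-1-q)] is at least [1] by the choice of
    [n], and a large [rho] absorbs the constants. *)
Lemma power_barrier_supersolution (p q M rho : R) n y :
  0 < q -> p <= 2 -> q < p - 1 ->
  1 <= n.+2%:R * (p - 1 - q) ->
  0 < M -> 1 <= rho ->
  N%:R * n.+2%:R * (n.+3%:R * M) `^ (p - 1 - q) <= rho ->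
  (forall i, `|y 0 i| <= rho) ->
  let A := M / rho ^+ n.+3 in
  let g : 'rV[R]_N := \row_i (A * (n.+3%:R * y 0 i ^+ n.+2)) in
  g != 0 ->
  enorm g `^ (p - 2) * \sum_i (A * n.+3%:R * (n.+2%:R * y 0 i ^+ n.+1)) <=
  enorm g `^ q.
Proof.
move=> q0 p2 qp hn M0 rho1 hrho yrho A g g0.
have rho0 : 0 < rho by apply: lt_le_trans rho1.
have A0 : 0 < A by rewrite divr_gt0 ?exprn_gt0.
set d := p - 1 - q in hn hrho.
have d0 : 0 < d by rewrite /d; lra.
have y0 : y != 0.
  apply: contraNneq g0 => E; apply/eqP/rowP => i.
  by rewrite mxE E !mxE expr0n /= !mulr0.
have [i0 Ei0] := norm_coord _ y0.
set X := `|y|.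
have X0 : 0 < X by rewrite normr_gt0.
have Xrho : X <= rho by rewrite /X Ei0.
pose Y := A * n.+3%:R * X ^+ n.+2.
have Y0 : 0 < Y by rewrite mulr_gt0 ?exprn_gt0 // mulr_gt0.
have YG : Y <= enorm g.
  apply: le_trans (coord_le_enorm _ i0); rewrite mxE normrM (gtr0_norm A0).
  by rewrite normrM normr_nat normrX -Ei0 mulrA.
have G0 : 0 < enorm g by apply: lt_le_trans YG.
have -> : enorm g `^ q = enorm g `^ (p - 2) * enorm g `^ (1 - d).
  by rewrite -powRD ?(gt_eqF G0) ?implybT //; congr (_ `^ _); rewrite /d; ring.
rewrite ler_wpM2l ?powR_ge0 //.
have Y1 : N%:R * n.+2%:R * Y `^ d <= X.
  have -> : Y = (n.+3%:R * M) * (rho^-1 * (X / rho) ^+ n.+2).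
    rewrite /Y /A expr_div_n exprS; field.
    by rewrite expf_eq0 /= (gt_eqF rho0).
  have Xr : 0 < X / rho <= 1.
    by rewrite divr_gt0 //= ler_pdivrMr // mul1r.
  have Xr0 : 0 <= X / rho by rewrite divr_ge0 // ltW.
  have Xrn : 0 <= (X / rho) ^+ n.+2 by exact: exprn_ge0.
  have rXrn : 0 <= rho^-1 * (X / rho) ^+ n.+2.
    by apply: mulr_ge0 => //; rewrite invr_ge0 ltW.
  rewrite powRM //; last by rewrite mulr_ge0 // ltW.
  rewrite mulrA; apply: (@le_trans _ _ (rho * (X / rho))); last first.
    by rewrite mulrC divfK ?gt_eqF.
  apply: ler_pM => //; [by rewrite mulr_ge0 ?powR_ge0|exact: powR_ge0|].
  apply: le_trans (ge1r_powR Xr hn); rewrite powRrM powR_mulrn //.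
  apply: ge0_ler_powR; rewrite ?nnegrE //; first exact: ltW.
  by rewrite ler_piMl // invf_le1.
apply: (@le_trans _ _ (Y `^ (1 - d))); last first.
  apply: ge0_ler_powR; rewrite ?nnegrE ?(ltW Y0) ?(ltW G0) //.
  by rewrite /d; lra.
apply: (@le_trans _ _ (N%:R * n.+2%:R * Y / X)); last first.
  rewrite ler_pdivrMr // powRB ?(gt_eqF Y0) ?implybT // powRr1 ?(ltW Y0) //.
  rewrite [leRHS]mulrAC ler_pdivlMr ?powR_gt0 //.
  by rewrite [leLHS]mulrAC [leRHS]mulrC ler_pM2r.
have -> : N%:R * n.+2%:R * Y / X =
    \sum_(i < N) (A * n.+3%:R * (n.+2%:R * X ^+ n.+1)).
  rewrite sumr_const card_ord -mulr_natl /Y exprS; field.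
  by rewrite gt_eqF.
apply: ler_sum => i _; apply: ler_wpM2l; first by rewrite mulr_ge0 // ltW.
apply: ler_wpM2l => //; apply: le_trans (ler_norm _) _; rewrite normrX.
by rewrite lerXn2r ?nnegrE ?(ltW X0) //; exact: coord_le_norm.
Qed.

End power_barrier.

Section space_time.
Context {R : realType} {N : nat}.

Lemma Ck_time k : Ck k setT (fun z : R * 'rV[R]_N => z.1).
Proof. by apply: Ck_additive => // z; exact: cvg_fst. Qed.

Lemma Ck_coord k i : Ck k setT (fun z : R * 'rV[R]_N => z.2 0 i).
Proof.
apply: Ck_additive => [z|s v z]; last by rewrite !mxE.
apply: (@continuous_comp _ _ _ snd (fun x : 'rV[R]_N => x 0 i)).
  exact: cvg_snd.
exact: coord_continuous.
Qed.

Lemma time_modulus0 : time_modulus (fun _ : R => 0 : R).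
Proof.
split=> //; first by apply: continuous_subspaceT => z; exact: cst_continuous.
by under eq_fun do rewrite mul0r; exact: cvg_cst.
Qed.

Lemma within_continuousB (K L : set (R * 'rV[R]_N)) (f g : R * 'rV[R]_N -> R) :
  L `<=` K -> {within K, continuous f} -> {in L, continuous g} ->
  {within L, continuous (fun z => f z - g z)}.
Proof.
move=> LK cf cg z.
have cf' : {within L, continuous f} by exact: continuous_subspaceW LK cf.
have cg' : {within L, continuous g} by exact: continuous_in_subspaceT.
exact: (cvgB (cf' z) (cg' z)).
Qed.

Section power_test_function.
Variables (a c e : R) (x0 : 'rV[R]_N) (n : nat).

Definition power_test (t : R) (x : 'rV[R]_N) : R :=
  (c + e * t) + \sum_i a * (x 0 i - x0 0 i) ^+ n.+3.

Lemma Ck_power_test k : Ck k setT (fun z : R * 'rV[R]_N => power_test z.1 z.2).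
Proof.
apply: CkD.
  apply: CkD; first exact: Ck_cst.
  by apply: CkM; [exact: Ck_cst|exact: Ck_time].
apply: Ck_sum => i; apply: CkM; first exact: Ck_cst.
by apply: CkX; apply: CkD; [exact: Ck_coord|exact: Ck_cst].
Qed.

Lemma dt_power_test t x : dt power_test t x = e.
Proof.
rewrite /dt /power_test derive1E.
have -> : (fun t => c + e * t + \sum_i a * (x 0 i - x0 0 i) ^+ n.+3) =
    cst (c + \sum_i a * (x 0 i - x0 0 i) ^+ n.+3) + (e \*: id).
  by apply/funext => s /=; rewrite addrAC.
by rewrite derive_val add0r /GRing.scale /= mulr1.
Qed.

Lemma grad_power_test t x :
  grad (power_test t) x = \row_i (a * (n.+3%:R * (x 0 i - x0 0 i) ^+ n.+2)).
Proof.
exact: (@grad_separable R N (fun i s => a * (s - x0 0 i) ^+ n.+3)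
  (fun i s => a * (n.+3%:R * (s - x0 0 i) ^+ n.+2)) (c + e * t)
  (fun i s => is_derive_pow a (x0 0 i) s n.+2) x).
Qed.

Hypothesis a0 : 0 < a.

Lemma grad_power_test_eq0 t x : grad (power_test t) x = 0 -> x = x0.
Proof.
rewrite grad_power_test => /rowP H; apply/rowP => i.
move: (H i); rewrite !mxE => /eqP.
rewrite mulf_eq0 (gt_eqF a0) /= mulf_eq0 pnatr_eq0 /= expf_eq0 /= subr_eq0.
by move=> /eqP.
Qed.

(** The only critical points lie on the line [x = x0], around which the test
    function minus its affine part in time is a sum of powers of the
    coordinates. *)
Lemma admissible_power_test (p : R) : 1 < n.+2%:R * (p - 1) ->
  admissible p power_test.
Proof.
move=> hn; split; first exact: Ck_subset (@subsetT _ _) (Ck_power_test 2).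
move=> t1 x1 t10 /grad_power_test_eq0 ->.
exists (fun r => (a * N.+1%:R) * r ^+ n.+3), (fun=> 0); split.
- by apply: class_F_pow => //; rewrite mulr_gt0.
- exact: time_modulus0.
apply: filterE => -[t x] /=; rewrite dt_power_test /power_test.
rewrite [X in _ - (_ + X)]big1 ?addr0; last first.
  by move=> i _; rewrite subrr expr0n /= mulr0.
rewrite [X in `|X|](_ : _ = \sum_i a * (x 0 i - x0 0 i) ^+ n.+3); last by ring.
apply: le_trans (ler_norm_sum _ _ _) _.
apply: (@le_trans _ _ (\sum_(i < N) a * enorm (x - x0) ^+ n.+3)).
  apply: ler_sum => i _; rewrite normrM (gtr0_norm a0) normrX ler_wpM2l ?(ltW a0) //.
  rewrite lerXn2r ?nnegrE ?enorm_ge0 //.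
  by have := coord_le_enorm (x - x0) i; rewrite !mxE.
have E0 : 0 <= enorm (x - x0) ^+ n.+3 by rewrite exprn_ge0 // enorm_ge0.
rewrite sumr_const card_ord -mulrA; set E := _ ^+ _ in E0 *.
rewrite -[a * E *+ N]mulrnAr -[E *+ N]mulr_natl.
by rewrite ler_pM2l // ler_wpM2r // ler_nat.
Qed.

End power_test_function.

End space_time.

(** * Local upper bounds and decay at infinity *)

Section decay.
Context {R : realType} {N : nat}.
Variables (p q M rho : R) (n : nat).
Variables (u0 : 'rV[R]_N -> R) (u : R -> 'rV[R]_N -> R).
Hypotheses (q0 : 0 < q) (p2 : p <= 2) (qp : q < p - 1).
Hypotheses (M0 : 0 < M) (rho1 : 1 <= rho).
Hypothesis hn : 1 <= n.+2%:R * (p - 1 - q).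
Hypothesis nodd : odd n.
Hypothesis hrho : N%:R * n.+2%:R * (n.+3%:R * M) `^ (p - 1 - q) <= rho.
Hypothesis hu : is_solution p q u0 u.
Hypothesis uM : forall t x, 0 <= t -> u t x <= M.

(** The barrier [psi] exceeds [M >= u] at distance [rho] from [x0] and exceeds
    [c >= u0] within this distance.  The slope [e] in time makes it a strict
    supersolution, also at the critical point [x0], and pushes it above [M] at
    the time [T].  The slope is chosen so small that [u t1 x0 > c] is still
    above the barrier at [(t1, x0)]. *)
Lemma local_upper_bound (x0 : 'rV[R]_N) (c : R) : 0 <= c ->
  (forall y : 'rV[R]_N, `|y - x0| <= rho -> u0 y <= c) ->
  forall t : R, 0 <= t -> u t x0 <= c.
Proof.
move=> c0 u0c t1 t10; rewrite leNgt; apply/negP => ct1.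
have [_ [_ cu] _ [_ sub _] u00] := hu.
have rho0 : 0 < rho by apply: lt_le_trans rho1.
pose a := M / rho ^+ n.+3.
have a0 : 0 < a by rewrite divr_gt0 ?exprn_gt0.
pose e := (u t1 x0 - c) / (2 * (t1 + 1)).
have t11 : 0 < t1 + 1 by rewrite ltr_wpDl.
have e0 : 0 < e by rewrite divr_gt0 ?subr_gt0 ?mulr_gt0.
have hn1 : 1 < n.+2%:R * (p - 1).
  by apply: le_lt_trans hn _; rewrite ltr_pM2l ?ltr0n // ltrBlDr ltrDl.
pose psi := power_test a c e x0 n.
pose T := t1 + M / e.
pose Z (z : R * 'rV[R]_N) := u z.1 z.2 - psi z.1 z.2.
have even_pow k (s : R) : ~~ odd k -> 0 <= s ^+ k.
  by move=> ek; rewrite exprn_even_ge0.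
have sum0 (x : 'rV[R]_N) : 0 <= \sum_i a * (x 0 i - x0 0 i) ^+ n.+3.
  apply: sumr_ge0 => i _; apply: mulr_ge0; rewrite ?(ltW a0) //.
  by rewrite even_pow //= nodd.
have far (x : 'rV[R]_N) i : rho <= `|x 0 i - x0 0 i| ->
    M <= \sum_i a * (x 0 i - x0 0 i) ^+ n.+3.
  move=> xi; rewrite (bigD1 i) //= -[leLHS]addr0 lerD //; last first.
    apply: sumr_ge0 => j _; apply: mulr_ge0; rewrite ?(ltW a0) //.
    by rewrite even_pow //= nodd.
  rewrite -[X in _ <= _ * X]ger0_norm ?even_pow //= ?nodd // normrX.
  rewrite /a mulrAC ler_pdivlMr ?exprn_gt0 // ler_wpM2l ?(ltW M0) //.
  by rewrite lerXn2r ?nnegrE ?(ltW rho0).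
have farx (x : 'rV[R]_N) : rho < `|x - x0| ->
    M <= \sum_i a * (x 0 i - x0 0 i) ^+ n.+3.
  move=> xr; have xx0 : x - x0 != 0.
    by rewrite -normr_gt0; apply: lt_trans xr.
  have [i Ei] := norm_coord _ xx0; apply: (far x i).
  by rewrite ltW // (lt_le_trans xr) // Ei !mxE.
have Zle (t : R) (x : 'rV[R]_N) : 0 <= t ->
    M <= \sum_i a * (x 0 i - x0 0 i) ^+ n.+3 -> Z (t, x) <= 0.
  move=> t0 Mx; rewrite subr_le0 /= /psi /power_test.
  apply: le_trans (uM _ x t0) _.
  by apply: le_trans Mx _; rewrite lerDr addr_ge0 // mulr_ge0 // ltW.
have T0 : 0 < T by rewrite ltr_wpDl // divr_gt0.
have cZ : {within [set z : R * 'rV[R]_N | 0 <= z.1 <= T], continuous Z}.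
  apply: within_continuousB cu _; first by move=> z /= /andP[].
  by move=> z _; exact: Ck_continuous (Ck_power_test a c e x0 n 0) z.
have Z0 (x : 'rV[R]_N) : Z (0, x) <= 0.
  have [xr|xr] := leP `|x - x0| rho; last by apply: Zle => //; exact: farx.
  rewrite subr_le0 /= /psi /power_test u00 mulr0 addr0.
  apply: le_trans (u0c _ xr) _.
  by rewrite lerDl.
have ZT (x : 'rV[R]_N) : Z (T, x) <= 0.
  rewrite subr_le0 /= /psi /power_test; apply: le_trans (uM _ x (ltW T0)) _.
  rewrite -addrA ler_wpDl // ler_wpDr // /T mulrDr [e * (M / e)]mulrC.
  rewrite divfK ?gt_eqF //.
  by rewrite ler_wpDl // mulr_ge0 // ltW.
have Zr (t : R) (x : 'rV[R]_N) : 0 <= t <= T -> `|x0| + rho + 1 <= `|x| ->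
    Z (t, x) <= 0.
  move=> /andP[t0 _] xr; apply: Zle => //; apply: farx.
  have := ler_normD (x - x0) x0; rewrite subrK => H; lra.
have t1T : 0 <= t1 <= T by rewrite t10 lerDl divr_ge0 // ltW.
have Zt1 : 0 < Z (t1, x0).
  rewrite subr_gt0 /= /psi /power_test big1 ?addr0; last first.
    by move=> i _; rewrite subrr expr0n /= mulr0.
  rewrite -ltrBrDl /e mulrAC ltr_pdivrMr ?mulr_gt0 // ltr_pM2l ?subr_gt0 //.
  lra.
have [t0 [x1 [t00 t0T Zpos Zmax]]] :=
  interior_maximum Z T _ t1 x0 cZ Z0 ZT Zr t1T Zt1.
have [/= subne sub0] :=
  sub psi t0 x1 (admissible_power_test a c e x0 n a0 p hn1) t00 Zmax.
have [g0|gn0] := eqVneq (grad (psi t0) x1) 0.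
  by have := sub0 g0; rewrite dt_power_test leNgt e0.
have := subne gn0; rewrite dt_power_test leNgt => /negP; apply.
apply: le_lt_trans e0; rewrite subr_le0.
have pl := @plaplacian_separable_le R N p
  (fun i s => a * (s - x0 0 i) ^+ n.+3)
  (fun i s => a * (n.+3%:R * (s - x0 0 i) ^+ n.+2))
  (fun i s => a * n.+3%:R * (n.+2%:R * (s - x0 0 i) ^+ n.+1))
  (c + e * t0) p2.
apply: le_trans (pl _ _ x1 gn0 _) _.
- by move=> i s; exact: is_derive_pow.
- move=> i s; have := is_derive_pow (a * n.+3%:R) (x0 0 i) s n.+1.
  rewrite (_ : (fun s : R => _) =
    (fun s => a * (n.+3%:R * (s - x0 0 i) ^+ n.+2))) //.
  by apply/funext => s'; rewrite mulrA.
- move=> i; apply: mulr_ge0; first by rewrite mulr_ge0 // ltW.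
  by apply: mulr_ge0 => //; rewrite even_pow //= nodd.
have gE : grad (psi t0) x1 =
    \row_i (a * (n.+3%:R * (x1 - x0) 0 i ^+ n.+2)).
  by rewrite grad_power_test; apply/rowP => i; rewrite !mxE.
rewrite gE; rewrite gE in gn0.
have bnd i : `|(x1 - x0) 0 i| <= rho.
  rewrite leNgt; apply/negP => H; move: Zpos; rewrite ltNge => /negP; apply.
  apply: Zle; first exact: ltW.
  by apply: (far x1 i); move: H; rewrite !mxE => /ltW.
have :=
  power_barrier_supersolution p q M rho n _ q0 p2 qp hn M0 rho1 hrho bnd gn0.
apply: le_trans; rewrite ler_wpM2l ?powR_ge0 // le_eqVlt; apply/orP; left.
by apply/eqP/eq_bigr => i _; rewrite !mxE.
Qed.

End decay.

Lemma uniform_decay {R : realType} {N : nat} (p q m C0 M : R)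
    (u0 : 'rV[R]_N -> R) (u : R -> 'rV[R]_N -> R) :
  0 < q -> p <= 2 -> q < p - 1 -> 0 < m -> 0 < C0 -> 0 < M ->
  (forall x, u0 x <= C0 * (1 + enorm x) `^ (- m)) ->
  is_solution p q u0 u -> (forall (t : R) x, 0 <= t -> u t x <= M) ->
  forall e : R, 0 < e ->
    exists r : R, forall (t : R) x, 0 <= t -> r <= `|x| -> u t x <= e.
Proof.
move=> q0 p2 qp m0 C00 M0 hdec hu uM e e0.
have d0 : 0 < p - 1 - q by lra.
(* [n] is odd, so that the exponents of the barrier are even. *)
pose j := Num.bound (p - 1 - q)^-1.
pose n := j.*2.+1.
have nodd : odd n by rewrite /n /= odd_double.
have hn : 1 <= n.+2%:R * (p - 1 - q).
  rewrite -ler_pdivrMr // mul1r.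
  have /ltW jj : (p - 1 - q)^-1 < j%:R.
    by apply: archi_boundP; rewrite invr_ge0 ltW.
  by apply: le_trans jj _; rewrite ler_nat /n -addnn; lia.
pose rho := 1 + N%:R * n.+2%:R * (n.+3%:R * M) `^ (p - 1 - q).
have h0 : 0 <= N%:R * n.+2%:R * (n.+3%:R * M) `^ (p - 1 - q).
  by rewrite mulr_ge0 ?powR_ge0.
have rho1 : 1 <= rho by rewrite lerDl.
have hrho : N%:R * n.+2%:R * (n.+3%:R * M) `^ (p - 1 - q) <= rho.
  by rewrite lerDr.
pose r0 := (C0 / e) `^ m^-1.
exists (r0 + rho) => t x t0 xr.
apply: (local_upper_bound p q M rho n u0 u q0 p2 qp M0 rho1 hn nodd hrho hu uM
  x e (ltW e0) _ t t0).
move=> y yx; apply: le_trans (hdec y) _.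
have r0y : r0 <= enorm y.
  apply: le_trans (norm_le_enorm y).
  have := ler_distD y x 0; rewrite !subr0 (distrC x y) => H; lra.
rewrite powRN ler_pdivrMr; last by rewrite powR_gt0 // ltr_wpDr // enorm_ge0.
rewrite mulrC -ler_pdivrMr //.
have -> : C0 / e = r0 `^ m.
  by rewrite /r0 -powRrM mulVf ?gt_eqF // powRr1 // divr_ge0 // ltW.
apply: ge0_ler_powR; rewrite ?nnegrE ?powR_ge0 ?(ltW m0) //.
  by rewrite addr_ge0 // enorm_ge0.
by apply: le_trans r0y _; rewrite lerDr.
Qed.


(** * The extinction profile *)

Section extinction_profile.
Context {R : realType}.

(** A convex decreasing power is touched from above at [y = 1] by an affine
    function of an exponential with the same slope: the rate [m + 2] makes the
    second derivative of the exponential [m (m + 2)], larger than that,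
    [m (m + 1)], of the power.  The bound on [y] is the range in which the
    comparison of the derivatives follows from [ln r <= r - 1]. *)
Lemma powR_le_exponential (m y : R) : 0 < m -> (m + 1) / (m + 2) <= y ->
  y `^ (- m) <= 1 - m / (m + 2) + m / (m + 2) * expR (- ((m + 2) * (y - 1))).
Proof.
move=> m0 my; set k := m + 2; have k0 : 0 < k by rewrite /k; lra.
have mk0 : 0 < (m + 1) / k by rewrite divr_gt0 //; lra.
pose F (y : R) := 1 - m / k + m / k * expR (- (k * (y - 1))) - y `^ (- m).
pose F' (y : R) := m * (y `^ (- m - 1) - expR (- (k * (y - 1)))).
have F1 : F 1 = 0 by rewrite /F subrr mulr0 oppr0 expR0 powR1; ring.
have dF (c : R) : 0 < c -> is_derive c (1 : R) F (F' c).
  move=> c0; have d1 : is_derive c (1 : R) (fun y : R => - (k * (y - 1))) (- k).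
    rewrite (_ : (fun y => _) = - (k \*: (id - cst 1))); last by apply/funext => x.
    by apply: is_derive_eq; rewrite subr0 /GRing.scale /= mulr1.
  have d2 := is_derive_compR expR _ _ _ _ _ (is_derive_expR _) d1.
  rewrite (_ : F = cst (1 - m / k) +
    ((m / k) \*: (fun y => expR (- (k * (y - 1))))) -
    (fun y : R => y `^ (- m))); last by apply/funext => x.
  have d3 := @is_derive1_powR R (- m) c c0.
  apply: is_derive_eq; rewrite /F' add0r /GRing.scale /=.
  by field; rewrite gt_eqF.
have cF (c : R) : 0 < c -> {for c, continuous F}.
  by move=> c0; apply/differentiable_continuous/derivable1_diffP; case: (dF c c0).
have wF (a b : R) : 0 < a -> {within `[a, b], continuous F}.
  move=> a0; apply: continuous_in_subspaceT => z.
  rewrite inE /= in_itv /= => /andP[az _].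
  exact: cF (lt_le_trans a0 az).
have dI (a b : R) : 0 < a ->
    forall x : R, x \in `]a, b[%R -> is_derive x (1 : R) F (F' x).
  move=> a0 x; rewrite in_itv /= => /andP[ax _].
  by apply: dF; exact: lt_trans ax.
have y0 : 0 < y by apply: lt_le_trans my.
have pE (c : R) : 0 < c -> c `^ (- m - 1) = expR (- ((m + 1) * ln c)).
  by move=> c0; rewrite /powR gt_eqF //; congr expR; ring.
rewrite -subr_ge0 -/(F y).
have [y1|y1|->] := ltgtP y 1; last by rewrite F1.
- have [c] := @MVT R F F' y 1 y1 (dI y 1 y0) (wF y 1 y0).
  rewrite in_itv /= F1 => /andP[yc c1] E.
  have c0 : 0 < c by apply: lt_trans yc.
  have -> : F y = - F' c * (1 - y) by rewrite mulNr -E; ring.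
  rewrite mulr_ge0 ?subr_ge0 ?(ltW y1) // oppr_ge0.
  rewrite pmulr_rle0 // subr_le0 pE // ler_expR lerN2.
  have l1 : - ln c <= c^-1 - 1.
    rewrite -lnV ?posrE // -{1}[c^-1](subrKC 1).
    by apply: le_ln1Dx; rewrite ltrBrDl addrN invr_gt0.
  have c2 : (m + 1) * (c^-1 - 1) <= - (k * (c - 1)).
    have -> : (m + 1) * (c^-1 - 1) = (1 - c) * ((m + 1) / c).
      by field; rewrite gt_eqF.
    have -> : - (k * (c - 1)) = (1 - c) * k by ring.
    rewrite ler_wpM2l ?subr_ge0 ?(ltW c1) // ler_pdivrMr // mulrC -ler_pdivrMr //.
    by rewrite (le_trans my) // ltW.
  rewrite -lerN2; apply: le_trans c2; rewrite -mulrN ler_pM2l //.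
  by lra.
- have [c] := @MVT R F F' 1 y y1 (dI 1 y ltr01) (wF 1 y ltr01).
  rewrite in_itv /= F1 subr0 => /andP[c1 cy] ->.
  have c0 : 0 < c by apply: lt_trans c1.
  rewrite mulr_ge0 ?subr_ge0 ?(ltW y1) //.
  rewrite pmulr_rge0 // subr_ge0 pE // ler_expR lerN2.
  have l1 : ln c <= c - 1.
    rewrite -{1}[c](subrKC 1); apply: le_ln1Dx; lra.
  apply: (@le_trans _ _ ((m + 1) * (c - 1))).
    by rewrite ler_pM2l //; lra.
  by rewrite ler_wpM2r ?subr_ge0 ?(ltW c1) // /k; lra.
Qed.

(** Powers of [D - s] are log-concave in [s]. *)
Lemma powR_le_tangent_exponential (a D s : R) : 0 <= a -> 0 < D -> s <= D ->
  (D - s) `^ a <= D `^ a * expR (- (a / D * s)).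
Proof.
move=> a0 D0 sD.
have -> : D - s = D * (1 - s / D) by field; rewrite gt_eqF.
have h : 0 <= 1 - s / D by rewrite subr_ge0 ler_pdivrMr // mul1r.
rewrite powRM ?(ltW D0) // ler_wpM2l ?powR_ge0 //.
have -> : - (a / D * s) = - (s / D) * a by ring.
rewrite expRM; apply: ge0_ler_powR; rewrite ?nnegrE ?expR_ge0 //.
exact: expR_ge1Dx.
Qed.

Definition profile (m K T b t s : R) : R :=
  K * (T - t) `^ (m + 1) * (b + s) `^ (- m).

(** [G] is the absolute value of the slope of the profile.  Half of [G^q]
    balances the time derivative: both are multiples of
    [(T - t)^m (b + s)^(-m)], as [(m + 1) q = m].  The other half balances the
    diffusion, because [G <= 1] and [(m + 2) / (b + s) <= 1 / 2].  The second
    derivative is taken with the factor [m + 2] of the exponential in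
    [powR_le_exponential] instead of [m + 1]. *)
Lemma profile_strict (p q m K T b t s : R) :
  0 < q -> q < 1 -> q < p - 1 -> m = q / (1 - q) -> 0 < K -> 0 < b ->
  (m + 1) * K <= (m * K) `^ q / 2 ->
  m * (K * T `^ (m + 1) * b `^ (- m)) <= b ->
  2 * (m + 2) <= b ->
  0 <= t -> t < T -> 0 <= s ->
  let a := profile m K T b t s in
  let G := a * m / (b + s) in
  0 < a /\ (m + 1) / (T - t) * a + (m + 2) / (b + s) * G `^ (p - 1) <= G `^ q.
Proof.
move=> q0 q1 qp hm K0 b0 hK hb1 hb2 t0 tT s0 a G.
have T0 : 0 < T by apply: le_lt_trans tT.
have q1' : 0 < 1 - q by lra.
have m0 : 0 < m by rewrite hm divr_gt0.
have D0 : 0 < T - t by rewrite subr_gt0.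
have r0 : 0 < b + s by lra.
have a0 : 0 < a by rewrite /a /profile mulr_gt0 ?powR_gt0 // mulr_gt0 ?powR_gt0.
split=> //.
have G0 : 0 < G by rewrite divr_gt0 // mulr_gt0.
have mq : (m + 1) * q = m by rewrite hm; field; rewrite gt_eqF.
have G1 : G <= 1.
  rewrite ler_pdivrMr // mul1r (le_trans (y := b)) ?lerDl //.
  apply: le_trans hb1; rewrite mulrC ler_pM2l // /a /profile.
  apply: ler_pM; rewrite ?powR_ge0 ?mulr_ge0 ?powR_ge0 ?(ltW K0) //.
    rewrite ler_pM2l //.
    by apply: ge0_ler_powR; rewrite ?nnegrE ?(ltW D0) ?(ltW T0) //; lra.
  rewrite !powRN lef_pV2 ?posrE ?powR_gt0 //.
  by apply: ge0_ler_powR; rewrite ?nnegrE ?(ltW m0) ?(ltW r0) ?(ltW b0) // lerDl.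
have e1 : (m + 1) / (T - t) * a =
    ((m + 1) * K) * ((T - t) `^ m * (b + s) `^ (- m)).
  rewrite /a /profile powRD ?(gt_eqF D0) ?implybT // powRr1 ?(ltW D0) //.
  by field; rewrite gt_eqF.
have e2 : G `^ q = (m * K) `^ q * ((T - t) `^ m * (b + s) `^ (- m)).
  have -> : G = (m * K) * ((T - t) `^ (m + 1) * (b + s) `^ (- (m + 1))).
    rewrite /G /a /profile opprD [(b + s) `^ (- m - 1)]powRD;
      last by rewrite (gt_eqF r0) implybT.
    by rewrite powR_inv1 ?(ltW r0) //; field; rewrite gt_eqF.
  rewrite powRM ?mulr_ge0 ?powR_ge0 ?(ltW m0) ?(ltW K0) //.
  by congr (_ * _); rewrite powRM ?powR_ge0 // -!powRrM mulNr mq.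
have h1 : (m + 1) / (T - t) * a <= G `^ q / 2.
  by rewrite e1 e2 [leRHS]mulrAC ler_wpM2r // mulr_ge0 ?powR_ge0.
have h2 : (m + 2) / (b + s) * G `^ (p - 1) <= G `^ q / 2.
  rewrite [leRHS]mulrC; apply: ler_pM; rewrite ?powR_ge0 //.
  - by rewrite divr_ge0 ?(ltW r0) //; lra.
  - by rewrite ler_pdivrMr //; lra.
  by apply: ger_powR; rewrite ?G0 // ltW.
lra.
Qed.

End extinction_profile.

(** * Exponential test functions *)

Section exponential_test_function.
Context {R : realType} {N : nat}.
Variables (alpha beta delta kappa nu lambda sigma t0 t1 s0 : R) (i0 : 'I_N).
Hypotheses (beta0 : 0 < beta) (lambda0 : 0 < lambda) (sigma1 : `|sigma| = 1).

Let c t : R :=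
  alpha * expR (- (kappa * (t - t0))) + delta * expR (nu * (t - t1)).
Let E t s : R :=
  beta * expR (- (kappa * (t - t0))) * expR (- (lambda * (sigma * s - s0))).

(** The sign [sigma] selects the side of the hyperplane [x_i0 = 0].  The term
    [delta * expR (nu * (t - t1))] is the penalty in time. *)
Definition exponential_test (t : R) (x : 'rV[R]_N) : R :=
  (alpha * expR (- (kappa * (t - t0))) + delta * expR (nu * (t - t1))) +
  beta * expR (- (kappa * (t - t0))) *
    expR (- (lambda * (sigma * x 0 i0 - s0))).

Let h t (i : 'I_N) s := if i == i0 then E t s else 0.
Let h1 t (i : 'I_N) s := if i == i0 then - (lambda * sigma * E t s) else 0.
Let h2 t (i : 'I_N) s := if i == i0 then lambda ^+ 2 * E t s else 0.

Lemma exponential_term_gt0 t s : 0 < E t s.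
Proof. by rewrite /E mulr_gt0 ?expR_gt0 // mulr_gt0 ?expR_gt0. Qed.

Lemma exponential_testE t :
  exponential_test t = fun x => c t + \sum_i h t i (x 0 i).
Proof.
apply/funext => x; rewrite (bigD1 i0) //= /h eqxx big1 ?addr0 // => i.
by move/negbTE ->.
Qed.

Lemma is_derive_affine_expR (a k s : R) (r : R) :
  is_derive r (1 : R) (fun r => a * expR (- (k * (s * r - s0))))
    (- (k * s * (a * expR (- (k * (s * r - s0)))))).
Proof.
have d1 : is_derive r (1 : R) (fun r : R => - (k * (s * r - s0))) (- (k * s)).
  rewrite (_ : (fun r => _) = - (k \*: ((s \*: id) - cst s0))); last first.
    by apply/funext => x.
  by apply: is_derive_eq; rewrite subr0 /GRing.scale /= mulr1.
have d2 := is_derive_compR expR _ _ _ _ _ (is_derive_expR _) d1.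
rewrite (_ : (fun r => a * _) =
  a \*: (fun r => expR (- (k * (s * r - s0))))); last by apply/funext => x.
by apply: is_derive_eq; rewrite /GRing.scale /=; ring.
Qed.

Lemma is_derive_exponential_term t i (s : R) : is_derive s (1 : R) (h t i) (h1 t i s).
Proof.
rewrite /h /h1; case: eqP => _; last exact: is_derive_cst.
exact: is_derive_affine_expR.
Qed.

Lemma is_derive_exponential_slope t i (s : R) : is_derive s (1 : R) (h1 t i) (h2 t i s).
Proof.
rewrite /h1 /h2; case: eqP => _; last exact: is_derive_cst.
have d := is_derive_affine_expR
  (- (lambda * sigma) * (beta * expR (- (kappa * (t - t0))))) lambda sigma s.
rewrite (_ : (fun s => _) =
  fun r => - (lambda * sigma) * (beta * expR (- (kappa * (t - t0)))) *
    expR (- (lambda * (sigma * r - s0)))).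
  apply: is_derive_eq.
  have s2 : sigma ^+ 2 = 1 by rewrite -real_normK ?num_real // sigma1 expr1n.
  rewrite -[lambda ^+ 2]mulr1 -s2 /E; ring.
by apply/funext => r; rewrite /E; ring.
Qed.

Lemma grad_exponential_test t x :
  grad (exponential_test t) x = \row_i h1 t i (x 0 i).
Proof.
rewrite exponential_testE.
exact: (@grad_separable R N (h t) (h1 t) (c t) (is_derive_exponential_term t) x).
Qed.

Lemma enorm_grad_exponential_test t x :
  enorm (grad (exponential_test t) x) = lambda * E t (x 0 i0).
Proof.
rewrite grad_exponential_test /enorm (bigD1 i0) //= mxE /h1 eqxx big1 ?addr0.
  rewrite sqrtr_sqr normrN normrM (gtr0_norm (exponential_term_gt0 _ _)).
  by rewrite normrM sigma1 mulr1 (gtr0_norm lambda0).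
by move=> i /negbTE ii0; rewrite mxE ii0 expr0n.
Qed.

(** Holds since the exponential is strictly monotone in [x_i0]; admissibility
    is then a mere matter of smoothness. *)
Lemma grad_exponential_test_neq0 t x : grad (exponential_test t) x != 0.
Proof.
apply/eqP => g0; have := enorm_grad_exponential_test t x.
by rewrite g0 enorm0 => /eqP; rewrite lt_eqF // mulr_gt0 ?exponential_term_gt0.
Qed.

Lemma plaplacian_exponential_test_le (p t : R) (x : 'rV[R]_N) : p <= 2 ->
  plaplacian p (exponential_test t) x <=
  enorm (grad (exponential_test t) x) `^ (p - 2) * (lambda ^+ 2 * E t (x 0 i0)).
Proof.
move=> p2; have := grad_exponential_test_neq0 t x.
have -> : lambda ^+ 2 * E t (x 0 i0) = \sum_i h2 t i (x 0 i).
  rewrite (bigD1 i0) //= /h2 eqxx big1 ?addr0 // => i.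
  by move/negbTE ->.
rewrite exponential_testE => g0.
apply: (@plaplacian_separable_le R N p (h t) (h1 t) (h2 t) (c t) p2
  (is_derive_exponential_term t) (is_derive_exponential_slope t)) => //.
move=> i; rewrite /h2; case: ifP => // _.
by rewrite mulr_ge0 ?sqr_ge0 // ltW ?exponential_term_gt0.
Qed.

Lemma Ck_exponential_test k :
  Ck k setT (fun z : R * 'rV[R]_N => exponential_test z.1 z.2).
Proof.
have Ct (a : R) : Ck k setT (fun z : R * 'rV[R]_N => z.1 - a).
  by apply: CkD; [exact: Ck_time|exact: Ck_cst].
have Ce : Ck k setT (fun z : R * 'rV[R]_N => expR (- (kappa * (z.1 - t0)))).
  apply: Ck_expR; rewrite (_ : (fun z => _) = (fun z => - kappa * (z.1 - t0))).
    by apply: CkM; [exact: Ck_cst|exact: Ct].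
  by apply/funext => z; rewrite mulNr.
apply: CkD.
  apply: CkD; first by apply: CkM; [exact: Ck_cst|].
  apply: CkM; first exact: Ck_cst.
  by apply: Ck_expR; apply: CkM; [exact: Ck_cst|].
apply: CkM; first by apply: CkM; [exact: Ck_cst|].
apply: Ck_expR.
rewrite (_ : (fun z => _) =
  (fun z : R * 'rV[R]_N => - lambda * (sigma * z.2 0 i0 + - s0))).
  apply: CkM; first exact: Ck_cst.
  apply: CkD; last exact: Ck_cst.
  by apply: CkM; [exact: Ck_cst|exact: Ck_coord].
by apply/funext => z; rewrite mulNr.
Qed.

Lemma admissible_exponential_test (p : R) : admissible p exponential_test.
Proof.
split; first exact: Ck_subset (@subsetT _ _) (Ck_exponential_test 2).
by move=> t x _ /eqP; rewrite (negbTE (grad_exponential_test_neq0 t x)).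
Qed.

Lemma dt_exponential_test (x : 'rV[R]_N) : sigma * x 0 i0 = s0 ->
  dt exponential_test t0 x =
  - kappa * (alpha + beta) + delta * nu * expR (nu * (t0 - t1)).
Proof.
move=> xs; rewrite /dt derive1E.
have d1 (a b k s : R) : is_derive s (1 : R) (fun t => a * expR (k * (t - b)))
    (a * k * expR (k * (s - b))).
  have d : is_derive s (1 : R) (fun t : R => k * (t - b)) k.
    rewrite (_ : (fun t => _) = k \*: (id - cst b)); last by apply/funext => r.
    by apply: is_derive_eq; rewrite subr0 /GRing.scale /= mulr1.
  have d2 := is_derive_compR expR _ _ _ _ _ (is_derive_expR _) d.
  rewrite (_ : (fun t => _) = a \*: (fun t => expR (k * (t - b)))); last first.
    by apply/funext => r.
  by apply: is_derive_eq; rewrite /GRing.scale /=; ring.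
have -> : exponential_test^~ x =
    (fun t => (alpha + beta) * expR (- kappa * (t - t0))) +
    (fun t => delta * expR (nu * (t - t1))).
  apply/funext => t; rewrite /exponential_test xs subrr mulr0 oppr0 expR0 mulr1.
  by rewrite [RHS]/GRing.add /= mulNr; ring.
have da := d1 (alpha + beta) t0 (- kappa) t0.
have db := d1 delta t1 nu t0.
by rewrite derive_val subrr mulr0 expR0; ring.
Qed.

End exponential_test_function.

(** * Comparison with the extinction profile *)

Section extinction.
Context {R : realType} {N : nat}.
Implicit Type u : R -> 'rV[R]_N -> R.

Lemma continuous_powR (a s : R) :
  0 < s -> {for s, continuous (fun r : R => r `^ a)}.
Proof.
move=> s0; apply/differentiable_continuous/derivable1_diffP.
by case: (@is_derive1_powR R a s s0).
Qed.

Lemma profile_ge0 (m K T b t s : R) : 0 <= K -> 0 <= profile m K T b t s.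
Proof. by move=> K0; rewrite mulr_ge0 ?powR_ge0 // mulr_ge0 ?powR_ge0. Qed.

Lemma profile_continuous (m K T b : R) (i0 : 'I_N) (z : R * 'rV[R]_N) :
  0 < b -> z.1 < T ->
  {for z, continuous (fun z : R * 'rV[R]_N => profile m K T b z.1 `|z.2 0 i0|)}.
Proof.
move=> b0 zT.
have c1 : {for z, continuous (fun z : R * 'rV[R]_N => (T - z.1) `^ (m + 1))}.
  apply: (@continuous_comp _ _ _ (fun z : R * 'rV[R]_N => T - z.1)
    (fun r : R => r `^ (m + 1))).
    by apply: cvgB; [exact: cvg_cst|exact: cvg_fst].
  by apply: continuous_powR; rewrite subr_gt0.
have c2 : {for z, continuous
    (fun z : R * 'rV[R]_N => (b + `|z.2 0 i0|) `^ (- m))}.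
  apply: (@continuous_comp _ _ _ (fun z : R * 'rV[R]_N => b + `|z.2 0 i0|)
    (fun r : R => r `^ (- m))).
    apply: cvgD; first exact: cvg_cst.
    apply: cvg_norm; exact: (Ck_continuous 0 _ (Ck_coord 0 i0)).
  by apply: continuous_powR; rewrite ltr_wpDr.
apply: cvgM; last exact: c2.
apply: cvgM; [exact: cvg_cst|exact: c1].
Qed.

(** A point [(t1, x1)] where [u > W] is excluded by looking at the maximum of
    [u - W - P], where the penalty [P] takes half the gap at [t1] and grows past
    [M] at the time [T' < T]. *)
Lemma profile_barrier (p q m C0 M K T b : R) (i0 : 'I_N) (u0 : 'rV[R]_N -> R) u :
  0 < q -> q < 1 -> p <= 2 -> q < p - 1 -> m = q / (1 - q) ->
  0 < M -> 0 < K -> 1 <= b -> 0 < T ->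
  (m + 1) * K <= (m * K) `^ q / 2 ->
  m * C0 <= b -> 2 * (m + 2) <= b ->
  K * T `^ (m + 1) = C0 * b `^ m ->
  (forall x, u0 x <= C0 * (1 + enorm x) `^ (- m)) ->
  is_solution p q u0 u -> (forall (t : R) x, 0 <= t -> u t x <= M) ->
  (forall e : R, 0 < e ->
    exists r : R, forall (t : R) x, 0 <= t -> r <= `|x| -> u t x <= e) ->
  forall (t : R) x, 0 <= t -> t < T -> u t x <= profile m K T b t `|x 0 i0|.
Proof.
move=> q0 q1 p2 qp hm M0 K0 b1 T0 hK hb1 hb2 hT hdec hu uM uinf t1 x1 t10 t1T.
have [_ [_ cu] _ [_ sub _] u00] := hu.
have b0 : 0 < b by lra.
have m0 : 0 < m by rewrite hm divr_gt0 // subr_gt0.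
have hb1' : m * (K * T `^ (m + 1) * b `^ (- m)) <= b.
  by rewrite hT -mulrA -powRD ?addrN ?powRr0 ?mulr1 // (gt_eqF b0) implybT.
pose W (z : R * 'rV[R]_N) := profile m K T b z.1 `|z.2 0 i0|.
have W0 z : 0 <= W z by apply: profile_ge0; rewrite ltW.
rewrite leNgt; apply/negP => uW.
pose delta := (u t1 x1 - W (t1, x1)) / 2.
have delta0 : 0 < delta by rewrite divr_gt0 // subr_gt0.
pose T' := (t1 + T) / 2.
have t1T' : t1 < T' by rewrite /T'; lra.
have T'T : T' < T by rewrite /T'; lra.
pose nu := M / (delta * (T' - t1)).
have nu0 : 0 < nu by rewrite divr_gt0 // mulr_gt0 // subr_gt0.
pose P (t : R) := delta * expR (nu * (t - t1)).
have P0 t : 0 < P t by rewrite mulr_gt0 ?expR_gt0.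
have PT' : M <= P T'.
  apply: (@le_trans _ _ (delta * (nu * (T' - t1)))).
    rewrite /nu le_eqVlt; apply/orP; left; apply/eqP.
    by field; rewrite !gt_eqF // subr_gt0.
  by rewrite ler_pM2l // (le_trans _ (expR_ge1Dx _)) // lerDr.
pose Z (z : R * 'rV[R]_N) := u z.1 z.2 - (W z + P z.1).
have cZ : {within [set z : R * 'rV[R]_N | 0 <= z.1 <= T'], continuous Z}.
  apply: within_continuousB cu _; first by move=> z /= /andP[].
  move=> z; rewrite inE /= => /andP[_ zT'].
  apply: cvgD.
    by apply: profile_continuous => //; apply: le_lt_trans T'T.
  have : Ck 0 setT (fun z : R * 'rV[R]_N => P z.1).
    apply: CkM; first exact: Ck_cst.
    apply: Ck_expR; apply: CkM; first exact: Ck_cst.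
    by apply: CkD; [exact: Ck_time|exact: Ck_cst].
  by move=> /Ck_continuous; apply.
have Z0 (x : 'rV[R]_N) : Z (0, x) <= 0.
  rewrite subr_le0 /= u00; apply: le_trans (hdec x) _.
  rewrite -[leLHS]addr0 lerD ?(ltW (P0 _)) //.
  rewrite /W /profile /= subr0 hT -mulrA ler_wpM2l //.
    rewrite -(pmulr_lge0 _ (powR_gt0 m b0)) -hT.
    by rewrite mulr_ge0 ?powR_ge0 // ltW.
  have bx : 0 < b + `|x 0 i0| by rewrite ltr_wpDr.
  have ex : 0 < 1 + enorm x by rewrite ltr_wpDr // enorm_ge0.
  rewrite !powRN ler_pdivlMr ?powR_gt0 // mulrC ler_pdivrMr ?powR_gt0 //.
  rewrite -powRM ?(ltW b0) ?(ltW ex) //.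
  apply: ge0_ler_powR; rewrite ?nnegrE ?(ltW m0) ?(ltW bx) ?mulr_ge0 //;
    rewrite ?(ltW b0) ?(ltW ex) //.
  rewrite mulrDr mulr1 lerD2l (le_trans (coord_le_enorm x i0)) //.
  by rewrite ler_peMl // enorm_ge0.
have ZT (x : 'rV[R]_N) : Z (T', x) <= 0.
  rewrite subr_le0 /=; apply: le_trans (uM _ x _) _.
    by rewrite (le_trans t10) // ltW.
  by apply: le_trans PT' _; rewrite lerDr.
have [r hr] := uinf _ (P0 0).
have Zr (t : R) (x : 'rV[R]_N) : 0 <= t <= T' -> r <= `|x| -> Z (t, x) <= 0.
  move=> /andP[t0 _] xr; rewrite subr_le0 /=; apply: le_trans (hr _ _ t0 xr) _.
  rewrite -[leLHS]add0r lerD // /P ler_pM2l // ler_expR ler_pM2l //.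
  by rewrite lerD2r.
have t1I : 0 <= t1 <= T' by rewrite t10 ltW.
have Zt1 : 0 < Z (t1, x1).
  rewrite /Z /P /= subrr mulr0 expR0 mulr1 /delta.
  by move: delta0; rewrite /delta; lra.
have [t0 [x0 [t00 t0T' Zpos Zmax]]] :=
  interior_maximum Z T' r t1 x1 cZ Z0 ZT Zr t1I Zt1.
have t0T : t0 < T by apply: lt_trans T'T.
(* The side of the ridge on which the maximum lies. *)
pose sigma : R := if 0 <= x0 0 i0 then 1 else -1.
have sigma1 : `|sigma| = 1.
  by rewrite /sigma; case: ifP; rewrite ?normrN normr1.
pose s0 := `|x0 0 i0|.
have s0E : sigma * x0 0 i0 = s0.
  rewrite /sigma /s0; case: (leP 0 (x0 0 i0)) => [h|h].
    by rewrite mul1r ger0_norm.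
  by rewrite mulN1r ltr0_norm.
have s00 : 0 <= s0 by exact: normr_ge0.
have r0 : 0 < b + s0 by rewrite ltr_wpDr.
have [] := profile_strict p q m K T b t0 s0 q0 q1 qp hm K0 b0 hK hb1' hb2
  (ltW t00) t0T s00.
set a := profile m K T b t0 s0 => a0 strict.
have k0 : 0 < m + 2 by lra.
pose kappa := (m + 1) / (T - t0).
pose lambda := (m + 2) / (b + s0).
have lambda0 : 0 < lambda by rewrite divr_gt0.
(* These make [alpha + beta] the value of the profile and [lambda * beta] the
   absolute value of its slope at the point of contact. *)
pose beta := a * (m / (m + 2)).
pose alpha := a * (1 - m / (m + 2)).
have beta0 : 0 < beta by rewrite mulr_gt0 // divr_gt0.
pose psi := exponential_test alpha beta delta kappa nu lambda sigma t0 t1 s0 i0.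
have adm : admissible p psi.
  exact: admissible_exponential_test.
have psi0 : psi t0 x0 = W (t0, x0) + P t0.
  rewrite /psi /exponential_test s0E !subrr !mulr0 oppr0 expR0 !mulr1.
  rewrite /W /= -/s0 -/a /P /alpha /beta.
  by ring.
(* Beyond the ridge, where [s < `|z.2 0 i0|], the continuation [(b + s) `^ (- m)]
   of the profile lies above [W], so that touching it from above is enough. *)
have touch : \forall z \near ((t0, x0) : R * 'rV[R]_N),
    W z + P z.1 <= psi z.1 z.2.
  have n1 : \forall z \near ((t0, x0) : R * 'rV[R]_N), z.1 < T.
    have := (Ck_continuous 0 _ (@Ck_time R N 0)) (t0, x0).
    by move=> /(_ [set t | t < T]); apply; exact: lt_nbhsl.
  have n2 : nbhs ((t0, x0) : R * 'rV[R]_N) [set z : R * 'rV[R]_N |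
      (m + 1) / (m + 2) * (b + s0) - b < sigma * z.2 0 i0].
    have C : Ck 0 setT (fun z : R * 'rV[R]_N => sigma * z.2 0 i0).
      by apply: CkM; [exact: Ck_cst|exact: Ck_coord].
    have := Ck_continuous 0 _ C (t0, x0).
    move=> /(_ [set s | (m + 1) / (m + 2) * (b + s0) - b < s]); apply => /=.
    apply: lt_nbhsr; rewrite s0E ltrBlDl gtr_pMl // ltr_pdivrMr // mul1r.
    by lra.
  near=> z.
  have zT : z.1 < T by near: z.
  have zs : (m + 1) / (m + 2) * (b + s0) - b < sigma * z.2 0 i0 by near: z.
  set s := sigma * z.2 0 i0 in zs *.
  have sle : s <= `|z.2 0 i0|.
    by apply: le_trans (ler_norm _) _; rewrite normrM sigma1 mul1r.
  have bs : (m + 1) / (m + 2) * (b + s0) < b + s by lra.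
  have bs0 : 0 < b + s.
    by apply: lt_trans bs; rewrite mulr_gt0 // divr_gt0 //; lra.
  pose y := (b + s) / (b + s0).
  have hy : (m + 1) / (m + 2) <= y by rewrite ler_pdivlMr // ltW.
  have y0 : 0 <= y by rewrite divr_ge0 // ltW.
  have D0 : 0 < T - t0 by rewrite subr_gt0.
  have tim := powR_le_tangent_exponential (m + 1) (T - t0) (z.1 - t0).
  have {}tim := tim (ltW (addr_gt0 m0 ltr01)) D0 ltac:(lra).
  rewrite (_ : T - t0 - (z.1 - t0) = T - z.1) in tim; last by ring.
  rewrite -/kappa in tim.
  have spa := powR_le_exponential m y m0 hy.
  have yE : (m + 2) * (y - 1) = lambda * (s - s0).
    by rewrite /y /lambda; field; rewrite gt_eqF.
  rewrite yE in spa.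
  have bsE : (b + s) `^ (- m) = (b + s0) `^ (- m) * y `^ (- m).
    by rewrite -powRM ?(ltW r0) // /y mulrC divfK ?gt_eqF.
  have -> : psi z.1 z.2 =
      K * ((T - t0) `^ (m + 1) * expR (- (kappa * (z.1 - t0)))) *
      ((b + s0) `^ (- m) *
        (1 - m / (m + 2) + m / (m + 2) * expR (- (lambda * (s - s0))))) +
      P z.1.
    by rewrite /psi /exponential_test /alpha /beta /a /profile /P -/s; ring.
  rewrite lerD2r /W /profile.
  apply: ler_pM; rewrite ?powR_ge0 ?mulr_ge0 ?powR_ge0 ?(ltW K0) //.
    by rewrite ler_pM2l.
  apply: (@le_trans _ _ ((b + s) `^ (- m))).
    rewrite !powRN lef_pV2 ?posrE ?powR_gt0 //; last by rewrite ltr_wpDr.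
    apply: ge0_ler_powR; rewrite ?nnegrE ?(ltW m0) ?(ltW bs0) ?addr_ge0 ?(ltW b0) //.
    by rewrite lerD2l.
  by rewrite bsE ler_wpM2l ?powR_ge0.
have Zmax' : \forall z \near ((t0, x0) : R * 'rV[R]_N),
    u z.1 z.2 - psi z.1 z.2 <= u t0 x0 - psi t0 x0.
  rewrite psi0; apply: filterS2 Zmax touch => z; rewrite /Z /= => h1 h2; lra.
have [/= subne _] := sub psi t0 x0 adm t00 Zmax'.
have gn0 : grad (psi t0) x0 != 0 by exact: grad_exponential_test_neq0.
have := subne gn0; rewrite (dt_exponential_test _ _ _ _ _ _ _ _ _ _ _ _ s0E).
have Eb : beta * expR (- (kappa * (t0 - t0))) *
    expR (- (lambda * (sigma * x0 0 i0 - s0))) = beta.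
  by rewrite s0E !subrr !mulr0 oppr0 expR0 !mulr1.
have pl : plaplacian p (psi t0) x0 <=
    enorm (grad (psi t0) x0) `^ (p - 2) * (lambda ^+ 2 * beta).
  by rewrite -Eb; exact: plaplacian_exponential_test_le.
have gE : enorm (grad (psi t0) x0) = lambda * beta.
  by rewrite -Eb; exact: enorm_grad_exponential_test.
set G := a * m / (b + s0) in strict.
have gG : enorm (grad (psi t0) x0) = G.
  by rewrite gE /G /lambda /beta; field; rewrite !gt_eqF.
have G0 : 0 < G by rewrite divr_gt0 // mulr_gt0.
have GE : G `^ (p - 2) * (lambda ^+ 2 * beta) =
    (m + 2) / (b + s0) * G `^ (p - 1).
  have -> : p - 1 = (p - 2) + 1 by ring.
  rewrite [G `^ (p - 2 + 1)]powRD ?(gt_eqF G0) ?implybT // powRr1 ?(ltW G0) //.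
  by rewrite /G /lambda /beta; field; rewrite !gt_eqF.
have ab : alpha + beta = a by rewrite /alpha /beta; ring.
move: pl; rewrite gG GE ab => pl H.
have pos : 0 < delta * nu * expR (nu * (t0 - t1)).
  by rewrite mulr_gt0 ?expR_gt0 // mulr_gt0.
rewrite -/kappa in strict.
by lra.
Unshelve. all: by end_near. Qed.

End extinction.

(** * Extinction *)

Lemma lower_bound_persists {R : realType} {N : nat} (u : R -> 'rV[R]_N -> R)
    (t0 c : R) (x : 'rV[R]_N) :
  {within [set z : R * 'rV[R]_N | 0 <= z.1], continuous (fun z => u z.1 z.2)} ->
  0 <= t0 -> c < u t0 x ->
  exists2 d : R, 0 < d & forall t : R, 0 <= t -> `|t0 - t| < d -> c < u t x.
Proof.
move=> /subspace_continuousP cu t00 cx.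
have := cu (t0, x) t00 [set s | c < s] (lt_nbhsr cx).
rewrite /= => /nbhs_ballP[d /= d0 sd]; exists d => // t tge td.
by apply: (sd (t, x)) => //; split => //=; exact: ballxx.
Qed.

(** [K] solves the first inequality with equality, [b] dominates the two lower
    bounds, and [T] is read off from the initial condition, which is why it
    comes last. *)
Lemma profile_constants {R : realType} (q C0 : R) : 0 < q -> q < 1 -> 0 < C0 ->
  let m := q / (1 - q) in
  exists K T b : R, [/\ 0 < K, 1 <= b, 0 < T & [/\
    (m + 1) * K <= (m * K) `^ q / 2, m * C0 <= b, 2 * (m + 2) <= b &
    K * T `^ (m + 1) = C0 * b `^ m]].
Proof.
move=> q0 q1 C00 m.
have q1' : 0 < 1 - q by rewrite subr_gt0.
have m0 : 0 < m by rewrite divr_gt0.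
have m1 : 0 < m + 1 by rewrite addr_gt0.
pose K := (m `^ q / (2 * (m + 1))) `^ (1 - q)^-1.
have mq0 : 0 < m `^ q / (2 * (m + 1)) by rewrite divr_gt0 ?powR_gt0 // mulr_gt0.
have K0 : 0 < K by rewrite powR_gt0.
pose b := 1 + m * C0 + 2 * (m + 2).
have mC0 : 0 < m * C0 by rewrite mulr_gt0.
have b0 : 0 < b by rewrite /b; lra.
exists K, ((C0 * b `^ m / K) `^ (m + 1)^-1), b; split => //.
- by rewrite /b; lra.
- by rewrite powR_gt0 // divr_gt0 // mulr_gt0 ?powR_gt0.
split.
- have KE : K = K `^ (1 - q) * K `^ q.
    rewrite -powRD ?(gt_eqF K0) ?implybT // subrK powRr1 //.
    exact: ltW.
  have Kq : K `^ (1 - q) = m `^ q / (2 * (m + 1)).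
    by rewrite /K -powRrM mulVf ?gt_eqF // powRr1 // ltW.
  rewrite powRM ?(ltW m0) ?(ltW K0) // {1}KE Kq le_eqVlt; apply/orP; left.
  by apply/eqP; field; rewrite gt_eqF.
- by rewrite /b; lra.
- by rewrite /b; lra.
rewrite -powRrM mulVf ?gt_eqF // powRr1; last first.
  by rewrite divr_ge0 ?(ltW K0) // mulr_ge0 ?powR_ge0 // ltW.
by rewrite mulrC divfK // gt_eqF.
Qed.

Theorem theorem1p3 (R : realType) (N : nat) (hN : (1 <= N)%N) (p q : R)
    (hpc : 2 * N%:R / (N%:R + 1) < p) (hp2 : p <= 2)
    (hq0 : 0 < q) (hqp : q < p - 1)
    (u0 : 'rV[R]_N -> R) (hu0W : W1oo u0)
    (hu0ge0 : forall x, 0 <= u0 x) (hu0neq0 : exists x, u0 x != 0)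
    (C0 : R) (hC0 : 0 < C0)
    (hdecay : forall x, u0 x <= C0 * (1 + enorm x) `^ (- (q / (1 - q))))
    (u : R -> 'rV[R]_N -> R) (hu : is_solution p q u0 u) :
  exists Te : R, [/\ 0 < Te,
    forall x, u Te x = 0 &
    forall t, 0 < t -> t < Te -> (0 < supnorm (u t))%E].
Proof.
have hq1 : q < 1 by lra.
have [u_ge0 [[M0 uM0] cu] _ _ u00] := hu.
pose M := `|M0| + 1.
have M_gt0 : 0 < M by rewrite ltr_wpDl.
have uM (t : R) x : 0 <= t -> u t x <= M.
  move=> t0; apply: le_trans (ler_norm _) _; apply: le_trans (uM0 t x t0) _.
  by rewrite (le_trans (ler_norm _)) // lerDl.
have m0 : 0 < q / (1 - q) by rewrite divr_gt0 // subr_gt0.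
have [K [T [b [K0 b1 T0 [hK hb1 hb2 hT]]]]] :=
  profile_constants q C0 hq0 hq1 hC0.
pose i0 : 'I_N := Ordinal hN.
have uinf :=
  uniform_decay p q _ C0 M u0 u hq0 hp2 hqp m0 hC0 M_gt0 hdecay hu uM.
have uW := profile_barrier p q _ C0 M K T b i0 u0 u hq0 hq1 hp2 hqp erefl
  M_gt0 K0 b1 T0 hK hb1 hb2 hT hdecay hu uM uinf.
have uT (x : 'rV[R]_N) : u T x = 0.
  apply/eqP; rewrite eq_le u_ge0 ?(ltW T0) // andbT leNgt; apply/negP => uTx.
  have e0 : 0 < u T x / 2 by rewrite divr_gt0.
  have [|d d0 hd] := lower_bound_persists u T (u T x / 2) x cu (ltW T0).
    by rewrite ltr_pdivrMr // ltr_pMr // ltr1n.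
  near T^'- => t.
  have tT : t < T by near: t; exact: nbhs_left_lt.
  have t0 : 0 < t by near: t; exact: nbhs_left_gt.
  have t1 : T - 1 < t by near: t; apply: nbhs_left_gt; rewrite ltrBlDr ltrDl.
  have td : T - d < t by near: t; apply: nbhs_left_gt; rewrite ltrBlDr ltrDl.
  have te : T - u T x / 2 / K < t.
    by near: t; apply: nbhs_left_gt; rewrite ltrBlDr ltrDl divr_gt0.
  have D0 : 0 < T - t by rewrite subr_gt0.
  have := hd t (ltW t0); rewrite gtr0_norm // => /(_ ltac:(lra)).
  apply/negP; rewrite -leNgt; apply: le_trans (uW t x (ltW t0) tT) _.
  apply: (@le_trans _ _ (K * (T - t) * 1)).
    rewrite /profile; apply: ler_pM; rewrite ?powR_ge0 //.
    - by rewrite mulr_ge0 ?powR_ge0 // ltW.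
    - rewrite ler_pM2l //; apply: ge1r_powR; last by rewrite lerDr ltW.
      by rewrite D0 /=; lra.
    rewrite powRN invf_le1 ?powR_gt0 //; last by rewrite ltr_wpDr //; lra.
    rewrite -[leLHS](powRr0 (b + `|x 0 i0|)); apply: ler_powR; last exact: ltW.
    by rewrite (le_trans b1) // lerDl.
  rewrite mulr1 mulrC -ler_pdivlMr //; lra.
pose S := [set t : R | 0 <= t /\ forall x, u t x = 0].
have ST : S T by split; [exact: ltW|].
have lbS : has_lbound S by exists 0 => t [].
have infS : has_inf S by split => //; exists T.
have Te0 : 0 <= inf S by apply: lb_le_inf; [exists T|move=> t []].
have SE : S (inf S).
  split=> // x; apply/eqP; rewrite eq_le u_ge0 // andbT leNgt; apply/negP => ux.
  have [d d0 hd] := lower_bound_persists u (inf S) 0 x cu Te0 ux.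
  have [t [t0 ut] tlt] := inf_adherent d0 infS.
  have ti : inf S <= t by apply: ge_inf.
  have := hd t t0; rewrite distrC ger0_norm ?subr_ge0 // ltrBlDl => /(_ tlt).
  by rewrite ut ltxx.
exists (inf S); split.
- rewrite lt_neqAle Te0 andbT; apply/eqP => E.
  have [x] := hu0neq0; have [_ /(_ x)] := SE.
  by rewrite -E u00 => ->; rewrite eqxx.
- by case: SE.
move=> t t0 tS.
have [x ux] : exists x, u t x != 0.
  apply: contrapT => H; move: tS; rewrite ltNge => /negP; apply.
  apply: ge_inf => //; split; first exact: ltW.
  by move=> x; apply/eqP/negPn/negP => ux; apply: H; exists x.
apply: (@lt_le_trans _ _ `|u t x|%:E); first by rewrite lte_fin normr_gt0.
by apply: ereal_sup_ubound; exists x.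
Unshelve. all: by end_near. Qed.
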